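(* Suppose $U\in\mathcal{CU}_\mu(\mathcal H)$ and $\mathbf B=b(U)\in\mathcal{SB}(\mathbb N_0)$. Then for every $\alpha\in\mathbb N_0$ the sequence $\mathbf B_{n,\alpha}$ converges strongly to $u_\alpha(U)\,\mathcal P_{\mathrm{Ker}(\mathbf B-I)}$ as $n\to\infty$, i.e. for every $x\in l^1(\mathbb N_0)$ $$\lim_{n\to\infty}\big\|\mathbf B_{n,\alpha}x-u_\alpha(U)\,\mathcal P_{\mathrm{Ker}(\mathbf B-I)}x\big\|_{l^1(\mathbb N_0)}=0 .$$
   Context: Let $\mu_j>0$ ($j\in\mathbb N_0=\{0,1,\dots\}$) with $\sum_j\mu_j=1$. $\mathcal H=l^2(\mathbb N_0,\mu)$ is the Hilbert space of complex sequences with $\langle x,y\rangle=\sum_j\mu_jx_j\overline{y_j}$, $\|x\|=\sqrt{\langle x,x\rangle}$. $\mathcal{CU}_\mu(\mathcal H)$ is the set of bounded linear operators $U$ on $\mathcal H$ with $\|Ux\|\le\|x\|$ for all $x$. Matrix entries: $(Ux)_j=\sum_kU_{jk}x_k$. For such $U$, $\mathbf B=b(U)$ is the operator on $l^1(\mathbb N_0)$ (norm $\sum_j|x_j|$) with matrix $\mathbf B_{jk}=\frac{\mu_j}{\mu_k}|U_{jk}|^2$; it lies in the set $\mathcal{SB}(\mathbb N_0)$ of operators on $l^1(\mathbb N_0)$ with nonnegative entries and all row and column sums at most $1$. For $\alpha\in\mathbb N_0$ put $a_\alpha^0(U)=1$ and, for $k\ge1$, $a_\alpha^k(U)=\sum_{j_{k-1},\dots,j_0\in\mathbb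 N_0}\mathbf B_{j_{k-1}j_{k-2}}\mathbf B_{j_{k-2}j_{k-3}}\cdots\mathbf B_{j_0\alpha}$. Put $u_\alpha(U)=\lim_{n\to\infty}\frac1n\sum_{k=1}^na_\alpha^k(U)$ and, for $n\ge1$, $\mathbf B_{n,\alpha}=\frac1n\sum_{j=0}^{n-1}a_\alpha^{n-1-j}(U)\,\mathbf B^j$. $\mathcal P_{\mathrm{Ker}(\mathbf B-I)}$ denotes the projection of $l^1(\mathbb N_0)$ onto $\mathrm{Ker}(\mathbf B-I)$ associated with the decomposition $l^1(\mathbb N_0)=\mathrm{Ker}(\mathbf B-I)\oplus\overline{\mathrm{Im}(\mathbf B-I)}$, i.e. $x_1+x_2\mapsto x_1$ for $x_1\in\mathrm{Ker}(\mathbf B-I)$, $x_2\in\overline{\mathrm{Im}(\mathbf B-I)}$.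
   Formalization: The decomposition of l^1 can fail (e.g. B the unilateral shift), so the projection need not be defined on all of l^1; convergence is stated for every x in Ker(B-I) + closure of Im(B-I), which is all of l^1 whenever the decomposition holds. *)

(* Defs.v *)
From HB Require Import structures.
From mathcomp Require Import all_boot all_order all_algebra.
From mathcomp Require Import all_classical all_reals all_analysis.
From mathcomp Require Export complex.
From mathcomp Require Import ring lra.

Set Implicit Arguments.
Unset Strict Implicit.
Unset Printing Implicit Defensive.

Import Order.TTheory GRing.Theory Num.Theory.
Import numFieldNormedType.Exports.
Import ComplexField.Normc.

Local Open Scope classical_set_scope.
Local Open Scope ring_scope.
Local Open Scope complex_scope.

Section l1.
Context {R : realType}.

Definition l1_sum (x : nat -> R[i]) : \bar R :=
  (\sum_(0 <= j <oo) (normc (x j))%:E)%E.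

Definition l1_pred : {pred nat -> R[i]} := [pred x | (l1_sum x < +oo)%E].

Fact normc_ge0 (z : R[i]) : 0 <= normc z.
Proof. by case: z => a b; exact: sqrtr_ge0. Qed.

Fact l1_sum_ge0 x : (0 <= l1_sum x)%E.
Proof. by apply: nneseries_ge0 => *; rewrite lee_fin normc_ge0. Qed.

Fact l1_sumD x y : (l1_sum (x + y)%R <= l1_sum x + l1_sum y)%E.
Proof.
rewrite -nneseriesD; [|by move=> *; rewrite lee_fin normc_ge0..].
apply: lee_nneseries => [n _ _|n _]; first by rewrite lee_fin normc_ge0.
by rewrite -EFinD lee_fin; exact: le_normcD.
Qed.

Fact l1_sumZ a x : (l1_sum (a *: x)%R = (normc a)%:E * l1_sum x)%E.
Proof.
rewrite -nneseriesZl; last by move=> *; rewrite lee_fin normc_ge0.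
by apply: eq_eseriesr => n _; rewrite -EFinM -normcM.
Qed.

Fact l1_sum0 : l1_sum 0 = 0%E.
Proof. by rewrite /l1_sum eseries0// => n _ _; rewrite normc0. Qed.

Fact l1_closed : submod_closed l1_pred.
Proof.
split=> [|a x y]; rewrite !inE ?l1_sum0 ?ltry// => hx hy.
apply: le_lt_trans (l1_sumD _ _) _; rewrite l1_sumZ.
rewrite lte_add_pinfty// -(@fineK _ (l1_sum x)) -?EFinM ?ltry//.
by rewrite ge0_fin_numE ?l1_sum_ge0.
Qed.

HB.instance Definition _ :=
  GRing.isSubmodClosed.Build _ (nat -> R[i]) l1_pred l1_closed.

Record l1 := L1 { l1val :> nat -> R[i]; l1P : l1val \in l1_pred }.

HB.instance Definition _ := [isSub for l1val].
HB.instance Definition _ := [Choice of l1 by <:].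
HB.instance Definition _ := [SubChoice_isSubLmodule of l1 by <:].

Definition l1norm (x : l1) : R := fine (l1_sum x).

Fact l1_fin (x : l1) : l1_sum x \is a fin_num.
Proof. by have := l1P x; rewrite inE ge0_fin_numE ?l1_sum_ge0. Qed.

Fact l1normD (x y : l1) : (l1norm (x + y))%:C <= (l1norm x)%:C + (l1norm y)%:C.
Proof.
rewrite -rmorphD lecR -lee_fin EFinD /l1norm !fineK ?l1_fin//.
exact: l1_sumD.
Qed.

Fact l1normZ (a : R[i]) (x : l1) : (l1norm (a *: x))%:C = `|a| * (l1norm x)%:C.
Proof.
by rewrite /l1norm l1_sumZ fineM ?l1_fin// rmorphM/=; congr (_ * _).
Qed.

Fact l1norm0_eq0 (x : l1) : (l1norm x)%:C = 0 -> x = 0.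
Proof.
move=> /complexI h; apply: val_inj; apply/funext => j /=.
apply/eq0_normc/eqP; rewrite eq_le normc_ge0 andbT.
have h0 : l1_sum x = 0%E by rewrite -(fineK (l1_fin x)) -/(l1norm x) h.
suff : ((normc (x j))%:E <= l1_sum x)%E by rewrite h0 lee_fin.
apply: le_trans (nneseries_lim_ge j.+1 _).
  rewrite big_mkord (bigD1 ord_max)//= leeDl// sume_ge0// => i _.
  by rewrite lee_fin normc_ge0.
by move=> *; rewrite lee_fin normc_ge0.
Qed.

HB.instance Definition _ :=
  Lmodule_isNormed.Build R[i] l1 l1normD l1normZ l1norm0_eq0.

End l1.
Arguments l1 R : clear implicits.

Section l2.
Context {R : realType} (mu : nat -> {posnum R}).

Definition l2_sum (x : nat -> R[i]) : \bar R :=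
  (\sum_(0 <= j <oo) ((mu j)%:num * normc (x j) ^+ 2)%:E)%E.

Definition l2_pred : {pred nat -> R[i]} := [pred x | (l2_sum x < +oo)%E].

Fact l2_term_ge0 x j : (0 <= ((mu j)%:num * normc (x j) ^+ 2)%:E)%E.
Proof. by rewrite lee_fin mulr_ge0 ?sqr_ge0. Qed.

Fact l2_closed : submod_closed l2_pred.
Proof.
split=> [|a x y]; rewrite !inE.
  by rewrite /l2_sum eseries0 ?ltry// => n _ _; rewrite normc0 expr0n/= mulr0.
move=> hx hy.
have fx : l2_sum x \is a fin_num.
  by rewrite ge0_fin_numE// nneseries_ge0// => n _ _; exact: l2_term_ge0.
have fy : l2_sum y \is a fin_num.
  by rewrite ge0_fin_numE// nneseries_ge0// => n _ _; exact: l2_term_ge0.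
apply: (@le_lt_trans _ _
  ((2 * normc a ^+ 2)%:E * l2_sum x + 2%:E * l2_sum y)%E); last first.
  by rewrite -(fineK fx) -(fineK fy) -!EFinM -EFinD ltry.
rewrite /l2_sum -!nneseriesZl; try by move=> *; exact: l2_term_ge0.
have a0 : 0 <= 2 * normc a ^+ 2 by rewrite mulr_ge0 ?sqr_ge0.
rewrite -nneseriesD;
  [|by move=> *; apply: mule_ge0; [rewrite lee_fin | exact: l2_term_ge0]..].
apply: lee_nneseries => [n _ _|n _]; first exact: l2_term_ge0.
rewrite -!EFinM -EFinD lee_fin.
have h : normc (a * x n + y n) <= normc a * normc (x n) + normc (y n).
  by rewrite -normcM; exact: le_normcD.
have m0 : 0 <= (mu n)%:num by [].
have {}h : normc (a * x n + y n) ^+ 2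
    <= 2 * (normc a * normc (x n)) ^+ 2 + 2 * normc (y n) ^+ 2.
  apply: le_trans (_ : (normc a * normc (x n) + normc (y n)) ^+ 2 <= _).
    by rewrite ler_sqr ?nnegrE ?addr_ge0 ?mulr_ge0 ?normc_ge0.
  rewrite -subr_ge0.
  rewrite (_ : _ - _ = (normc a * normc (x n) - normc (y n)) ^+ 2) ?sqr_ge0//.
  by ring.
apply: le_trans (ler_wpM2l m0 h) _.
rewrite le_eqVlt; apply/orP; left; apply/eqP; ring.
Qed.

HB.instance Definition _ :=
  GRing.isSubmodClosed.Build _ (nat -> R[i]) l2_pred l2_closed.

Record l2 := L2 { l2val :> nat -> R[i]; l2P : l2val \in l2_pred }.

HB.instance Definition _ := [isSub for l2val].
HB.instance Definition _ := [Choice of l2 by <:].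
HB.instance Definition _ := [SubChoice_isSubLmodule of l2 by <:].

Definition l2norm (x : l2) : R := Num.sqrt (fine (l2_sum x)).

Fact l2_unit_seq k : (fun j => (j == k)%:R : R[i]) \in l2_pred.
Proof.
rewrite inE /l2_sum (nneseries_split 0 k.+1); last first.
  by move=> i _; exact: (@l2_term_ge0 (fun j => (j == k)%:R)).
rewrite eseries0 ?adde0; first by rewrite sumEFin ltry.
move=> n + _; rewrite add0n => kn.
by rewrite gtn_eqF// normc0 expr0n/= mulr0.
Qed.

Definition unit_seq (k : nat) : l2 := L2 (l2_unit_seq k).

Definition l2_contraction (U : l2 -> l2) := forall x, l2norm (U x) <= l2norm x.

(* The entry U_jk is the j-th coordinate of U applied to the k-th unit
   sequence, whose norm in H is sqrt (mu k). *)
Definition mxentry (U : l2 -> l2) (j k : nat) : R[i] := U (unit_seq k) j.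

Definition bmx (U : l2 -> l2) (j k : nat) : R :=
  (mu j)%:num / (mu k)%:num * normc (mxentry U j k) ^+ 2.

End l2.

Section matop.
Context {R : realType}.

Definition mxact (M : nat -> nat -> R) (x : nat -> R[i]) (j : nat) : R[i] :=
  limn (series (fun k => (M j k)%:C * x k : R[i]^o)).

(* [insubd] falls back to 0 when the image sequence is not in l1; [matopP] and
   [bmx_col] below show that this never happens for the matrix of b(U). *)
Definition matop (M : nat -> nat -> R) (x : l1 R) : l1 R :=
  insubd (0 : l1 R) (mxact M x).

Lemma normcE_re (z : R[i]) : `|z| = (normc z)%:C.
Proof. by case: z. Qed.

Lemma normc_series_le (f : nat -> R[i]) :
  ((normc (limn (series (f : nat -> R[i]^o))))%:E
     <= \sum_(0 <= k <oo) (normc (f k))%:E)%E.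
Proof.
have [cf|ncf] := pselect (cvgn (series (f : nat -> R[i]^o))); last first.
  rewrite (dvgP ncf) normc0; apply: nneseries_ge0 => *.
  by rewrite lee_fin normc_ge0.
have [->|] := eqVneq (\sum_(0 <= k <oo) (normc (f k))%:E)%E +oo%E.
  by rewrite leey.
rewrite -ltey => hS.
have fS : (\sum_(0 <= k <oo) (normc (f k))%:E)%E \is a fin_num.
  by rewrite ge0_fin_numE// nneseries_ge0// => *; rewrite lee_fin normc_ge0.
rewrite leNgt; apply/negP; rewrite -(fineK fS) lte_fin => Sl.
set f' : nat -> R[i]^o := f in cf Sl *.
have e0 : 0 < (normc (limn (series f')) - fine (\sum_(0 <= k <oo) (normc (f k))%:E)%E)%:C.
  by rewrite ltcR subr_gt0.
have /cvgrPdist_lt/(_ _ e0)[N _ /(_ N (leqnn N))] := cf.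
rewrite /= normcE_re ltcR ltrBrDl => h.
have sN : normc (series f' N) <= fine (\sum_(0 <= k <oo) (normc (f k))%:E)%E.
  rewrite -lee_fin fineK//.
  apply: le_trans (nneseries_lim_ge N _); last by move=> *; rewrite lee_fin normc_ge0.
  rewrite sumEFin lee_fin -lecR -normcE_re /series/= rmorph_sum/=.
  apply: le_trans (ler_norm_sum _ _ _) _.
  by apply: ler_sum => i _; rewrite normcE_re.
have : normc (limn (series f')) <= normc (limn (series f') - series f' N) + normc (series f' N).
  by rewrite -[X in normc X <= _](subrK (series f' N)); exact: le_normcD.
by move: h sN; lra.
Qed.

Definition col_sub (M : nat -> nat -> R) :=
  (forall j k, 0 <= M j k) /\
  (forall k, (\sum_(0 <= j <oo) (M j k)%:E <= 1)%E).

Lemma matopP M : col_sub M -> forall x : l1 R,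
  (matop M x = mxact M x :> (nat -> R[i])) /\ l1norm (matop M x) <= l1norm x.
Proof.
move=> [M0 M1] x.
have le1 : (l1_sum (mxact M x) <= l1_sum x)%E.
  apply: le_trans (_ : (\sum_(0 <= j <oo) \sum_(0 <= k <oo)
      (M j k * normc (x k))%:E <= _)%E).
    apply: lee_nneseries => [*|j _]; first by rewrite lee_fin normc_ge0.
    apply: le_trans (normc_series_le _) _.
    rewrite le_eqVlt; apply/orP; left; apply/eqP.
    apply: eq_eseriesr => k _; rewrite normcM; congr (_ * _)%:E.
    by rewrite /normc/= expr0n/= addr0 sqrtr_sqr ger0_norm.
  rewrite nneseries_interchange; last first.
    by move=> *; rewrite lee_fin mulr_ge0 ?normc_ge0.
  apply: lee_nneseries => [*|k _].
    by apply: nneseries_ge0 => *; rewrite lee_fin mulr_ge0 ?normc_ge0.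
  under eq_eseriesr do rewrite mulrC EFinM.
  rewrite nneseriesZl; last by move=> *; rewrite lee_fin.
  by rewrite -[leRHS]mule1 lee_wpmul2l// lee_fin normc_ge0.
have hM : mxact M x \in l1_pred.
  by rewrite inE (le_lt_trans le1)//; have := l1P x; rewrite inE.
have -> : matop M x = L1 hM.
  by apply: val_inj; rewrite /matop /insubd insubT.
split=> //; rewrite /l1norm fine_le ?l1_fin//=.
Qed.

Lemma l2_fin (mu : nat -> {posnum R}) (x : l2 mu) : l2_sum mu x \is a fin_num.
Proof.
have := l2P x; rewrite inE ge0_fin_numE//.
by apply: nneseries_ge0 => *; exact: l2_term_ge0.
Qed.

Lemma l2_sum_unit_seq (mu : nat -> {posnum R}) k :
  l2_sum mu (unit_seq mu k) = ((mu k)%:num)%:E.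
Proof.
rewrite /l2_sum (@nneseriesD1 _ _ k)//=; last by move=> j _; exact: (l2_term_ge0 mu (unit_seq mu k)).
rewrite eqxx normc1 expr1n mulr1 eseries0 ?adde0// => j _ /negbTE jk.
by rewrite jk normc0 expr0n/= mulr0.
Qed.

Lemma bmx_col (mu : nat -> {posnum R}) (U : l2 mu -> l2 mu) :
  l2_contraction U -> col_sub (bmx U).
Proof.
move=> cU; split=> [j k|k].
  by rewrite mulr_ge0 ?sqr_ge0// divr_ge0.
have -> : (\sum_(0 <= j <oo) (bmx U j k)%:E)%E
    = (((mu k)%:num^-1)%:E * l2_sum mu (U (unit_seq mu k)))%E.
  rewrite -nneseriesZl; last by move=> *; exact: l2_term_ge0.
  by apply: eq_eseriesr => j _; rewrite -EFinM mulrA [_^-1 * _]mulrC.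
have : (l2_sum mu (U (unit_seq mu k)) <= ((mu k)%:num)%:E)%E.
  rewrite -l2_sum_unit_seq -(fineK (l2_fin (U _))) -(fineK (l2_fin (unit_seq _ _))).
  rewrite lee_fin; have := cU (unit_seq mu k); rewrite /l2norm.
  have h (x : l2 mu) : 0 <= fine (l2_sum mu x).
    by apply: fine_ge0; apply: nneseries_ge0 => *; exact: l2_term_ge0.
  by rewrite ler_psqrt ?nnegrE.
rewrite -(fineK (l2_fin (U _))) lee_fin -EFinM lee_fin => h.
by rewrite mulrC ler_pdivrMr// mul1r.
Qed.

End matop.

Section averages.
Context {R : realType} {mu : nat -> {posnum R}}.
Implicit Types (U : l2 mu -> l2 mu) (B : l1 R -> l1 R) (alpha : nat).

Definition bop U : l1 R -> l1 R := matop (bmx U).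

(* The tuple s lists j_0, ..., j_(k-1), so that (alpha :: s)_i is the column
   index of the i-th factor; for k = 0 the only tuple is empty. *)
Definition acoef U alpha (k : nat) : R :=
  fine (\esum_(s in [set: k.-tuple nat])
    (\prod_(i < k) bmx U (nth 0%N s i) (nth 0%N (alpha :: s) i))%:E)%E.

Definition ulim U alpha : R :=
  limn (fun n : nat => n%:R^-1 * \sum_(1 <= k < n.+1) acoef U alpha k).

Definition Bavg U alpha (n : nat) (x : l1 R) : l1 R :=
  ((n%:R^-1)%:C : R[i]) *:
    \sum_(j < n) (acoef U alpha (n - 1 - j))%:C *: iter j (bop U) x.

Definition ker1 B : set (l1 R) := [set x | B x - x = 0].

Definition im1 B : set (l1 R) := range (fun x => B x - x).

(* The domain Ker(B - I) + closure of Im(B - I) of the projection.  It need not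
   be all of l1: when B is the unilateral shift, which is b(U) for the isometry
   sending e_k to sqrt (mu k / mu (k+1)) e_(k+1), the kernel is 0 and every
   element of the closure of Im(B - I) has coordinates summing to 0.  Here e_k
   is [unit_seq mu k]. *)
Definition projker_dom B : set (l1 R) :=
  [set x1 + x2 | x1 in ker1 B & x2 in closure (im1 B)].

(* x1 + x2 |-> x1 on projker_dom B, and 0 elsewhere *)
Definition projker B (x : l1 R) : l1 R :=
  xget 0 [set x1 | ker1 B x1 /\ closure (im1 B) (x - x1)].

End averages.

(* Main.v *)
(* The numbers a^k are the l^1 norms of B^k e_alpha.  As the column sums of B are
   at most 1, they decrease from a^0 = 1, so they converge, and by Cesaro's lemma
   their limit is u_alpha.  On Ker(B - I) the operator B_n acts as multiplication
   by the mean of a^0, ..., a^(n-1), which tends to u_alpha.  On Im(B - I),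
   monotonicity of a and summation by parts give ||B_n (B y - y)|| <= 2 ||y|| / n.
   Since ||B_n|| <= 1, B_n also tends to 0 on the closure of Im(B - I). *)
Require Import Defs.
From HB Require Import structures.
From mathcomp Require Import all_boot all_order all_algebra.
From mathcomp Require Import all_classical all_reals all_analysis.
From mathcomp Require Import complex.
From mathcomp Require Import zify ring lra.

Set Implicit Arguments.
Unset Strict Implicit.
Unset Printing Implicit Defensive.

Import Order.TTheory GRing.Theory Num.Theory.
Import numFieldNormedType.Exports.
Import ComplexField.Normc.

Local Open Scope classical_set_scope.
Local Open Scope ring_scope.
Local Open Scope complex_scope.

(** * Complex limits and additivity of the matrix operator *)

Lemma normc_le_abs (R : rcfType) (a b : R) :
  normc (a +i* b) <= `|a| + `|b|.
Proof.
have -> : a +i* b = a%:C + (0 +i* b) by rewrite /real_complex_def; simpc.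
apply: le_trans (le_normcD _ _) _.
by rewrite /= !expr0n/= addr0 add0r !sqrtr_sqr.
Qed.

Lemma cvg_complex (R : realType) (a b : nat -> R) (u v : R) :
  a @ \oo --> u -> b @ \oo --> v ->
  (fun n => a n +i* b n : R[i]^o) @ \oo --> (u +i* v : R[i]^o).
Proof.
move=> au bv; apply/cvgrPdist_lt => e e0.
(* The order on [R[i]] compares only numbers with equal imaginary parts, so a positive [e] is
   real. *)
have [e1 e1E] : exists e1 : R, e = e1%:C.
  by case: e e0 => e1 e2; rewrite ltcE/= => /andP[/eqP-> _]; exists e1.
rewrite {}e1E ltcR in e0 *.
have e20 : 0 < e1 / 2 by lra.
move/cvgrPdist_lt/(_ _ e20): au => au; move/cvgrPdist_lt/(_ _ e20): bv => bv.
near=> n.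
rewrite normcE_re ltcR.
have -> : (u +i* v : R[i]) - (a n +i* b n) = (u - a n) +i* (v - b n) by simpc.
apply: le_lt_trans (normc_le_abs _ _) _.
have h1 : `|u - a n| < e1 / 2 by near: n.
have h2 : `|v - b n| < e1 / 2 by near: n.
lra.
Unshelve. all: by end_near. Qed.

(** The real and imaginary parts are dominated by the modulus, so both real series converge by
    comparison. *)
Lemma abs_cvg_series (R : realType) (f : nat -> R[i]) : f \in l1_pred ->
  cvgn (series (f : nat -> R[i]^o)).
Proof.
rewrite inE => hf.
have n0 k : 0 <= normc (f k) by exact: normc_ge0.
have cn : cvgn (series (fun k => normc (f k))).
  apply: nondecreasing_is_cvgn.
    by apply/nondecreasing_seqP => n; rewrite /series/= big_nat_recr//= lerDl.
  exists (fine (l1_sum f)) => _ [n _ <-].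
  rewrite -lee_fin fineK ?ge0_fin_numE ?l1_sum_ge0//.
  rewrite /series/= -sumEFin; apply: nneseries_lim_ge => *.
  by rewrite lee_fin.
have part (g : nat -> R) : (forall k, `|g k| <= normc (f k)) ->
    cvgn (series g).
  move=> gf; apply: normed_cvg.
  by apply: (@series_le_cvg _ _ (fun k => normc (f k))) => //= k.
have /part cRe : forall k, `|complex.Re (f k)| <= normc (f k).
  move=> k; case: (f k) => a b /=.
  by rewrite -sqrtr_sqr ler_wsqrtr// lerDl sqr_ge0.
have /part cIm : forall k, `|complex.Im (f k)| <= normc (f k).
  move=> k; case: (f k) => a b /=.
  by rewrite -sqrtr_sqr ler_wsqrtr// lerDr sqr_ge0.
suff <- : (fun n => series (fun k => complex.Re (f k)) n +i*
    series (fun k => complex.Im (f k)) n) = series f.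
  exact: cvgP (cvg_complex cRe cIm).
apply/funext => n; rewrite /series/=; elim/big_rec3: _ => //= k x y z _ <-.
by case: (f k) => a b; simpc.
Qed.

(** [mxact] is a [limn], which respects differences only where the series converge. They do on [l1]:
    each entry of [M] is at most its column sum, hence at most 1, so every row series converges
    absolutely. *)
Lemma matopB (R : realType) (M : nat -> nat -> R) : col_sub M ->
  {morph matop M : x y / x - y}.
Proof.
move=> Msub x y; have [M0 M1] := Msub.
have Mle j k : M j k <= 1.
  rewrite -lee_fin (le_trans _ (M1 k))//.
  apply: le_trans (nneseries_lim_ge j.+1 _); last by move=> *; rewrite lee_fin.
  by rewrite big_nat_recr//= leeDr// sume_ge0// => *; rewrite lee_fin.
have cv j (z : l1 R) : cvgn (series (fun k => (M j k)%:C * z k : R[i]^o)).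
  apply: abs_cvg_series; rewrite inE.
  have := l1P z; rewrite inE; apply: le_lt_trans.
  apply: lee_nneseries => [*|k _]; first by rewrite lee_fin normc_ge0.
  rewrite lee_fin normcM ler_piMl ?normc_ge0//.
  by rewrite /normc/= expr0n/= addr0 sqrtr_sqr ger0_norm.
apply: val_inj => /=.
rewrite (matopP Msub (x - y)).1 /=.
rewrite [RHS](_ : _ = mxact M x - mxact M y); last first.
  by rewrite -(matopP Msub x).1 -(matopP Msub y).1.
apply/funext => j; apply: (etrans _ (limB (cv j x) (cv j y))).
congr (limn _); apply/funext => n; rewrite /series/=.
etransitivity; last exact: sumrB.
by apply: eq_bigr => k _; rewrite mulrBr.
Qed.

(** * Sums over paths and summation by parts *)

(** Splitting off the last index [j] of a path leaves the weight of the shorter path times an entry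
    in row [j]; summing over [j] first gives a column sum, at most 1. *)
Lemma esum_tuple_step (R : realType) (M : nat -> nat -> R) (alpha k : nat) :
  col_sub M ->
  (\esum_(s in [set: k.+1.-tuple nat])
    (\prod_(i < k.+1) M (nth 0%N s i) (nth 0%N (alpha :: s) i))%:E <=
   \esum_(s in [set: k.-tuple nat])
    (\prod_(i < k) M (nth 0%N s i) (nth 0%N (alpha :: s) i))%:E)%E.
Proof.
move=> [M0 M1].
pose w (s : k.-tuple nat) :=
  \prod_(i < k) M (nth 0%N s i) (nth 0%N (alpha :: s) i).
have w0 s : 0 <= w s by apply: prodr_ge0.
pose e (p : k.-tuple nat * nat) : k.+1.-tuple nat := [tuple of rcons p.1 p.2].
rewrite (@reindex_esum _ _ _ ([set: k.-tuple nat] `*`` fun=> [set: nat]) _ e).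
  rewrite (eq_esum (b := fun p => (w p.1 * M p.2 (nth 0%N (alpha :: p.1) k))%:E)).
    rewrite -(esum_esum (a := fun s j => (w s * M j (nth 0%N (alpha :: s) k))%:E)).
      apply: le_esum => s _.
      rewrite -(nneseries_esumT
        (a := fun j => (w s * M j (nth 0%N (alpha :: s) k))%:E)).
        under eq_eseriesr do rewrite EFinM.
        rewrite nneseriesZl; last by move=> *; rewrite lee_fin.
        by rewrite -[leRHS]mule1 lee_wpmul2l// lee_fin.
      by move=> *; rewrite lee_fin mulr_ge0.
    by move=> *; rewrite lee_fin mulr_ge0.
  move=> [s j] _ /=; congr EFin; rewrite big_ord_recr/=; congr (_ * _).
    apply: eq_bigr => i _; rewrite -rcons_cons !nth_rcons/= size_tuple.
    by rewrite ltn_ord ltnS ltnW.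
  (* The column of the last factor is entry [k] of [alpha :: s], which is the last index of [s], or
     [alpha] when [k = 0]. *)
  rewrite -rcons_cons !nth_rcons/= size_tuple.
  by rewrite ltnn eqxx leqnn.
split => //.
- move=> [s j] [t l] _ _ /(congr1 val)/= /rcons_inj[st ->].
  by congr pair; apply: val_inj.
- move=> t _; case/tupleP: {t}(t : k.+1.-tuple nat) (erefl t) => x s _.
  exists (belast_tuple x s, last x s) => //.
  by apply: val_inj; rewrite /= -lastI.
Qed.

(* Abel summation: the sum is [a n *: z n - a 0 *: z 0] plus the sum of the
   [(a j - a j.+1) *: z j.+1], whose coefficients are nonnegative and telescope. *)
Lemma norm_abel_sum_le (K : numFieldType) (V : normedModType K) (a : nat -> K)
    (z : nat -> V) (c : K) (n : nat) :
  (forall k, 0 <= a k) -> (forall k, a k.+1 <= a k) ->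
  (forall k, `|z k| <= c) ->
  `|\sum_(j < n) a j *: (z j.+1 - z j)| <= 2 * a 0%N * c.
Proof.
move=> a0 adec zc.
have -> : \sum_(j < n) a j *: (z j.+1 - z j) =
    a n *: z n - a 0%N *: z 0%N + \sum_(j < n) (a j - a j.+1) *: z j.+1.
  elim: n => [|n IHn]; first by rewrite !big_ord0 subrr addr0.
  rewrite !big_ord_recr/= IHn scalerBr scalerBl; set S := \sum_(i < n) _.
  rewrite addrC addrA subrKA [S + _]addrC [RHS]addrA [a n.+1 *: _ - _ + _]addrC.
  by rewrite subrKA.
have bnd (b : K) w : 0 <= b -> `|w| <= c -> `|b *: w| <= b * c.
  by move=> b0 wc; rewrite normrZ ger0_norm// ler_wpM2l.
apply: (le_trans (ler_normD _ _)).
have -> : 2 * a 0%N * c = (a n * c + a 0%N * c) + \sum_(j < n) (a j - a j.+1) * c.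
  rewrite -mulr_suml (_ : \sum_(i < n) _ = a 0%N - a n); first by ring.
  by elim: n => [|n IHn]; rewrite ?big_ord0 ?subrr// big_ord_recr/= IHn; ring.
apply: lerD.
  by apply: (le_trans (ler_normB _ _)); apply: lerD; exact: bnd.
apply: (le_trans (ler_norm_sum _ _ _)); apply: ler_sum => i _.
by apply: bnd => //; rewrite subr_ge0.
Qed.

(** * Weighted averages of the iterates of a nonexpansive map *)

Section weighted_averages.
Context {R : realType} {V : normedModType R[i]}.
Variables (B : V -> V) (a : nat -> R).
Hypothesis BB : {morph B : x y / x - y}.
Hypothesis Ble : forall x, `|B x| <= `|x|.
Hypothesis a0 : forall k, 0 <= a k.
Hypothesis adec : forall k, a k.+1 <= a k.
Hypothesis a01 : a 0%N <= 1.

(** The shape of [Bavg], with [bop U] and [acoef U alpha] replaced by any [B] and [a] satisfying the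
    hypotheses above. *)
Definition wavg (n : nat) (x : V) : V :=
  ((n%:R^-1)%:C : R[i]) *: \sum_(j < n) (a (n - 1 - j))%:C *: iter j B x.

Lemma iterB j : {morph iter j B : x y / x - y}.
Proof. by elim: j => // j IHj x y; rewrite !iterS IHj BB. Qed.

Lemma norm_iter_le j x : `|iter j B x| <= `|x|.
Proof. by elim: j => //= j; apply: le_trans. Qed.

Lemma wavgB n : {morph wavg n : x y / x - y}.
Proof.
move=> x y; rewrite /wavg -scalerBr -sumrB; congr (_ *: _).
by apply: eq_bigr => j _; rewrite -scalerBr iterB.
Qed.

Lemma weight_le1 k : a k <= 1.
Proof. by elim: k => // k; apply: le_trans. Qed.

Lemma norm_wavg_le n x : `|wavg n x| <= `|x|.
Proof.
rewrite normrZ; have [->|n0] := posnP n.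
  by rewrite invr0 normr0 mul0r.
have nR : 0 <= (n%:R^-1 : R) by rewrite invr_ge0.
rewrite ger0_norm ?lecR//.
have h : `|\sum_(j < n) (a (n - 1 - j))%:C *: iter j B x| <= n%:R * `|x|.
  apply: (le_trans (ler_norm_sum _ _ _)).
  rewrite -[n in leRHS]card_ord mulr_natl -sumr_const; apply: ler_sum => j _.
  rewrite normrZ ger0_norm ?lecR// -[leRHS]mul1r.
  by apply: ler_pM; rewrite ?lecR ?weight_le1 ?norm_iter_le.
apply: (le_trans (ler_wpM2l _ h)); first by rewrite lecR.
by rewrite fmorphV/= rmorph_nat mulrA mulVf ?mul1r// pnatr_eq0 -lt0n.
Qed.

(** Reversing the sum attaches the decreasing weight [a j] to a difference of consecutive terms of
    [z j = iter (n - j) B x], the form required by [norm_abel_sum_le]. *)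
Lemma norm_wavg_im_le n x : `|wavg n (B x - x)| <= (2 * n%:R^-1)%:C * `|x|.
Proof.
have -> : wavg n (B x - x) = (n%:R^-1)%:C *:
    (- \sum_(j < n) (a j)%:C *: (iter (n - j.+1) B x - iter (n - j) B x)).
  rewrite /wavg (reindex_inj rev_ord_inj)/= -sumrN; congr (_ *: _).
  apply: eq_bigr => j _; rewrite -scalerN opprB iterB -iterSr subnSK//.
  by have -> : (n - 1 - (n - j.+1) = j)%N by have := ltn_ord j; lia.
rewrite scalerN normrN normrZ ger0_norm ?lecR ?invr_ge0//.
rewrite rmorphM/= [2%:C * _]mulrC -mulrA ler_wpM2l ?lecR ?invr_ge0//.
(* For [j >= n] the truncated [n - j] is 0 and [z j = x], so the bound on [z] holds at every
   index. *)
apply: le_trans (norm_abel_sum_le (a := fun j => (a j)%:C)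
   (z := fun j => iter (n - j) B x) (c := `|x|) n _ _ _) _ => [k|k|k|].
- by rewrite lecR.
- by rewrite lecR.
- exact: norm_iter_le.
rewrite -mulrA rmorph_nat ler_wpM2l// -[leRHS]mul1r ler_wpM2r//.
by rewrite lecR.
Qed.

Lemma wavg_ker n x : B x - x = 0 ->
  wavg n x = (n%:R^-1 * \sum_(j < n) a j)%:C *: x.
Proof.
move=> /eqP; rewrite subr_eq0 => /eqP Bx.
have itx j : iter j B x = x by elim: j => //= j ->.
rewrite /wavg rmorphM/= -scalerA; congr (_ *: _).
rewrite rmorph_sum/= scaler_suml (reindex_inj rev_ord_inj)/=.
apply: eq_bigr => j _; rewrite itx.
by have -> : (n - 1 - (n - j.+1) = j)%N by have := ltn_ord j; lia.
Qed.

Lemma wavg_cvg (u : R) (x1 x2 : V) :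
  n%:R^-1 * \sum_(j < n) a j @[n --> \oo] --> u ->
  B x1 - x1 = 0 -> closure (range (fun y => B y - y)) x2 ->
  wavg n (x1 + x2) @[n --> \oo] --> u%:C *: x1.
Proof.
move=> mu_ x1ker x2im.
have wD n : wavg n (x1 + x2) = wavg n x1 + wavg n x2.
  by rewrite -[LHS](subrK (wavg n x1)) -wavgB [x1 + x2]addrC addrK addrC.
under eq_fun do rewrite wD.
rewrite -[u%:C *: x1]addr0; apply: cvgD.
  under eq_fun do rewrite wavg_ker//.
  apply: cvgZr_tmp.
  exact: (cvg_complex mu_ (cvg_cst 0)).
apply/cvgr0Pnorm_lt => e e0.
have e20 : 0 < e / 2 by rewrite divr_gt0.
(* [B y - y] approximates [x2] within [e / 2]; [wavg n] does not enlarge this error. *)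
have [_ [[y _ <-]]] := x2im _ (nbhsx_ballx _ _ e20).
rewrite -ball_normE/= => ye.
have [r rE] : exists r : R, `|y| = r%:C.
  have := normr_ge0 y; case: `|y| => r1 r2; rewrite lecE/= => /andP[/eqP-> _].
  by exists r1.
have [d dE] : exists d : R, e = d%:C.
  by case: (e) e0 => e1 e2; rewrite ltcE/= => /andP[/eqP-> _]; exists e1.
have d0 : 0 < d by rewrite -ltcR -dE.
near=> n.
(* This threshold makes the bound [2 * r / n] on the image part less than [d / 2]. *)
have nr : 4 * r / d < n%:R by near: n; exact: nbhs_infty_gtr.
have n0 : 0 < (n%:R : R) by rewrite ltr0n; near: n; exact: nbhs_infty_gt.
rewrite [ltRHS]splitr.
have -> : wavg n x2 = wavg n (x2 - (B y - y)) + wavg n (B y - y).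
  by rewrite wavgB subrK.
apply: (le_lt_trans (ler_normD _ _)); apply: ltr_leD.
  exact: le_lt_trans (norm_wavg_le _ _) ye.
apply: (le_trans (norm_wavg_im_le _ _)).
have -> : e / 2 = (d / 2)%:C by rewrite dE rmorphM/= fmorphV/= rmorph_nat.
rewrite rE -rmorphM lecR mulrAC ler_pdivrMr//.
by move: nr; rewrite ltr_pdivrMr//; lra.
Unshelve. all: by end_near. Qed.
End weighted_averages.

(** * Convergence of the coefficients *)

Lemma cesaro_ord (R : archiRealFieldType) (u : nat -> R) (l : R) :
  u @ \oo --> l -> n%:R^-1 * \sum_(j < n) u j @[n --> \oo] --> l.
Proof.
(* [arithmetic_mean u n] averages the first [n.+1] terms, hence the shift. *)
move=> /cesaro ul; rewrite -(cvg_shiftS (fun n => n%:R^-1 * \sum_(j < n) u j)).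
apply: cvg_trans ul; apply: near_eq_cvg; near=> n.
by rewrite /arithmetic_mean /series/= big_mkord.
Unshelve. all: by end_near. Qed.

Section acoef_theory.
Context {R : realType} {mu : nat -> {posnum R}}.
Variables (U : l2 mu -> l2 mu) (alpha : nat).
Hypothesis cU : l2_contraction U.

Let w k (s : k.-tuple nat) : R :=
  \prod_(i < k) bmx U (nth 0%N s i) (nth 0%N (alpha :: s) i).

Let esum_w_ge0 k : (0 <= \esum_(s in [set: k.-tuple nat]) (w s)%:E)%E.
Proof.
apply: esum_ge0 => s _; rewrite lee_fin; apply: prodr_ge0 => i _.
by have [+ _] := bmx_col cU.
Qed.

Let esum_w0 : (\esum_(s in [set: 0.-tuple nat]) (w s)%:E = 1)%E.
Proof.
rewrite (_ : [set: _] = [set [tuple]]); last first.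
  by apply/seteqP; split => // t _; rewrite [t]tuple0.
by rewrite esum_set1 /w big_ord0.
Qed.

(** Finiteness lets [fine] carry the inequalities between these sums over to [acoef]. *)
Let esum_w_fin k : (\esum_(s in [set: k.-tuple nat]) (w s)%:E)%E \is a fin_num.
Proof.
rewrite ge0_fin_numE//; apply: (@le_lt_trans _ _ 1%E); last exact: ltry.
elim: k => [|k]; first by rewrite esum_w0.
by apply: le_trans; exact: esum_tuple_step (bmx_col cU).
Qed.

Lemma acoef0 : acoef U alpha 0 = 1.
Proof. by rewrite /acoef esum_w0. Qed.

Lemma acoef_ge0 k : 0 <= acoef U alpha k.
Proof. exact: fine_ge0. Qed.

Lemma acoef_le k : acoef U alpha k.+1 <= acoef U alpha k.
Proof.
by apply: fine_le; [exact: esum_w_fin..|exact: esum_tuple_step (bmx_col cU)].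
Qed.

Lemma acoef_cvg : acoef U alpha @ \oo --> ulim U alpha.
Proof.
have ca : cvgn (acoef U alpha).
  apply: nonincreasing_is_cvgn; first exact/nonincreasing_seqP/acoef_le.
  by exists 0 => _ [k _ <-]; exact: acoef_ge0.
suff -> : ulim U alpha = limn (acoef U alpha) by [].
apply: cvg_lim => //.
(* The means in [ulim] run over indices 1 to [n], so they are the Cesaro means of the shifted
   sequence. *)
have /cesaro_ord : (fun k => acoef U alpha k.+1) @ \oo --> limn (acoef U alpha).
  by rewrite (cvg_shiftS (acoef U alpha)).
by apply: cvg_trans; apply: near_eq_cvg; near=> n; rewrite big_add1 big_mkord.
Unshelve. all: by end_near. Qed.
End acoef_theory.

Theorem lemma3p8 (R : realType) (mu : nat -> {posnum R})
  (mu_sum1 : (\sum_(0 <= j <oo) ((mu j)%:num)%:E = 1)%E)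
  (U : {linear l2 mu -> l2 mu}) (U_contraction : l2_contraction U) :
  forall (alpha : nat) (x : l1 R), projker_dom (bop U) x ->
    l1norm (Bavg U alpha n x - (ulim U alpha)%:C *: projker (bop U) x)
      @[n --> \oo] --> (0 : R).
Proof.
move=> alpha x [x1 x1ker [x2 x2im xE]].
have Bsub := bmx_col U_contraction.
have BB : {morph bop U : x y / x - y} by exact: matopB.
have Ble y : `|bop U y| <= `|y| by rewrite lecR; exact: (matopP Bsub y).2.
(* The given decomposition of [x] shows that the set in [projker] is inhabited, so the value chosen
   by [xget] lies in it. *)
have [kerP imP] : ker1 (bop U) (projker (bop U) x) /\
    closure (im1 (bop U)) (x - projker (bop U) x).
  apply: (@xgetPex _ 0 [set z | ker1 (bop U) z /\ closure (im1 (bop U)) (x - z)]).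
  exists x1; split => //; rewrite -xE.
  by rewrite [X in closure _ X](_ : _ = x2)// addrC addKr.
have a01 : acoef U alpha 0 <= 1 by rewrite acoef0.
have := wavg_cvg BB Ble (acoef_ge0 alpha U_contraction)
  (acoef_le alpha U_contraction) a01
  (cesaro_ord (acoef_cvg U_contraction)) kerP imP.
rewrite [_ + (x - _)]addrC subrK => h.
apply/cvgrPdist_lt => e e0.
(* The norm of the normed module [l1 R] takes values in [R[i]]; [l1norm] is its real version. *)
have e0C : 0 < e%:C by rewrite ltcR.
move/cvgrPdist_lt/(_ _ e0C): h; apply: filterS => n.
rewrite distrC sub0r normrN ltcR ger0_norm//.
exact: fine_ge0 (l1_sum_ge0 _).
Qed.
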